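(* (a) For every $v\geq 8$ there exists a connected symmetric configuration $v_3$ whose minimum blocking set cardinality is exactly $\lceil v/3\rceil+1$. (b) For $v=12$ and for every $v\geq 15$ there exists a connected symmetric configuration $v_3$ whose minimum blocking set cardinality is exactly $\lceil v/3\rceil+2$.
   Context: A symmetric configuration $v_3$ consists of a set of $v$ points and a collection of $v$ blocks, each block being a 3-element subset of the points, such that every point lies in exactly 3 blocks and any two distinct points lie in at most one common block. It is connected if it is not the union of two configurations on disjoint nonempty point sets. A blocking set is a subset $Q$ of the points such that every block contains at least one point of $Q$ and at least one point not in $Q$. The minimum blocking set cardinality of a configuration is the smallest cardinality of a blocking set of it (assuming one exists). *)

(* Defs.v *)
From mathcomp Require Import all_boot.
Set Implicit Arguments. Unset Strict Implicit. Unset Printing Implicit Defensive.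

(* A symmetric configuration v_3 on point set 'I_v: v blocks indexed by 'I_v,
   block i is the 3-subset B i of points. *)
Definition is_config3 (v : nat) (B : 'I_v -> {set 'I_v}) : Prop :=
  (forall i, #|B i| = 3) /\
  (forall x : 'I_v, #|[set i | x \in B i]| = 3) /\
  (forall x y : 'I_v, x != y -> #|[set i | (x \in B i) && (y \in B i)]| <= 1).

Definition config_connected (v : nat) (B : 'I_v -> {set 'I_v}) : Prop :=
  ~ exists S : {set 'I_v},
      [/\ S != set0, ~: S != set0 &
          forall i, (B i \subset S) \/ (B i \subset ~: S)].

Definition blocking_set (v : nat) (B : 'I_v -> {set 'I_v}) (Q : {set 'I_v}) : Prop :=
  forall i, (B i :&: Q != set0) /\ (B i :\: Q != set0).

Definition min_blocking_card (v : nat) (B : 'I_v -> {set 'I_v}) (k : nat) : Prop :=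
  (exists Q, blocking_set B Q /\ #|Q| = k) /\
  (forall Q, blocking_set B Q -> k <= #|Q|).

Definition ceil3 (v : nat) : nat := (v + 2) %/ 3.

(* Main.v *)
Require Import Defs.
From mathcomp Require Import all_boot.
Set Implicit Arguments. Unset Strict Implicit. Unset Printing Implicit Defensive.

(** Deleting a line from the Fano plane leaves a structure on 7 points in which
the three points of the deleted line have degree 2, and in every blocking set of
which these three points get the same colour.  Hence a point [p] of a
configuration can be replaced by this structure, each of the three blocks
through [p] receiving one point of the deleted line: blocking sets of the new
configuration restrict to blocking sets of the old one.  The extra six points
contribute at least two elements to a blocking set, and exactly two can be
achieved when [p] is in the old blocking set.  Expanding a point of a minimum
blocking set thus adds 6 to the number of points and 2 to the blocking number,
and the theorem reduces to finitely many small configurations (found by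
computer search), for which everything is checked by computation. *)

(** * Configurations as boolean incidence relations *)

Section Incidence.
Variable v : nat.
Implicit Types (A : 'I_v -> 'I_v -> bool) (Q : 'I_v -> bool).

Definition configuration A :=
  [/\ forall i, \sum_x A i x = 3, forall x, \sum_i A i x = 3
    & forall x y, x != y -> \sum_i (A i x && A i y) <= 1].

(** Colourings constant on blocks replace partitions: they can be restricted to the old points of an
    expansion, and enumerated as bit words. *)
Definition connected_inc A :=
  forall S : 'I_v -> bool, (forall i x y, A i x -> A i y -> S x = S y) ->
  forall x y, S x = S y.

Definition blocks A Q :=
  forall i, (exists2 x, A i x & Q x) /\ (exists2 x, A i x & ~~ Q x).

Definition blocking_number A k :=
  (exists2 Q, blocks A Q & \sum_x Q x = k) /\
  (forall Q, blocks A Q -> k <= \sum_x Q x).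

Definition realizes A k :=
  [/\ configuration A, connected_inc A & blocking_number A k].

Definition realizable k := exists A, realizes A k.

Lemma realizable_blocks k : realizable k ->
  exists B : 'I_v -> {set 'I_v},
    [/\ is_config3 B, config_connected B & min_blocking_card B k].
Proof.
case=> A [[rowA colA pairA] conA [[Q blQ cQ] minA]].
have cardE (D : {set 'I_v}) : #|D| = \sum_x (x \in D).
  by rewrite -sum1_card big_mkcond; apply: eq_bigr => x _; case: (x \in D).
have blocksE (D : {set 'I_v}) i : let B := [set x | A i x] in
    B :&: D != set0 /\ B :\: D != set0 <->
    (exists2 x, A i x & x \in D) /\ (exists2 x, A i x & x \notin D).
  split=> [[/set0Pn[x] + /set0Pn[y]]|[[x Ax Dx] [y Ay Dy]]].
    by rewrite !inE => /andP[Ax Dx] /andP[Dy Ay]; split; [exists x | exists y].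
  by split; apply/set0Pn; [exists x | exists y]; rewrite !inE ?Ax ?Ay ?Dx ?Dy.
exists (fun i => [set x | A i x]); split.
- split=> [i|].
    by rewrite -(rowA i) cardE; apply: eq_bigr => x _; rewrite inE.
  split=> [x|x y neq_xy].
    by rewrite -(colA x) cardE; apply: eq_bigr => i _; rewrite !inE.
  apply: leq_trans (pairA x y neq_xy).
  by rewrite cardE; apply: leq_sum => i _; rewrite !inE.
- case=> S [/set0Pn[x Sx] /set0Pn[y]]; rewrite inE => Sy monoS.
  suff: (x \in S) = (y \in S) by rewrite Sx (negPf Sy).
  apply: (conA (fun z => z \in S)) => i {Sx Sy}x {}y Ax Ay.
  by case: (monoS i) => /subsetP sub; move: (sub x) (sub y); rewrite !inE;
    [move=> /(_ Ax)-> /(_ Ay)-> | move=> /(_ Ax)/negPf-> /(_ Ay)/negPf->].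
- split=> [|Q' blQ']; last by rewrite cardE; apply: minA => i; apply/blocksE.
  exists [set x | Q x]; split=> [i|].
    by apply/blocksE; have [[x Ax Qx] [y Ay Qy]] := blQ i; split;
      [exists x | exists y]; rewrite ?inE.
  by rewrite cardE -cQ; apply: eq_bigr => x _; rewrite inE.
Qed.

End Incidence.

(** * The Fano plane without one line *)

(* The line {0, 1, 2} is the one left out. *)
Definition fano_lines : seq (seq nat) :=
  [:: [:: 0; 3; 4]; [:: 0; 5; 6]; [:: 1; 3; 5]; [:: 1; 4; 6]; [:: 2; 3; 6];
      [:: 2; 4; 5]].

Definition fano_minus_line (j k : nat) : bool := k \in nth [::] fano_lines j.

Lemma fano_minus_line_connected (c : nat -> bool) :
  (forall j k l, fano_minus_line j k -> fano_minus_line j l -> c k = c l) ->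
  forall k, k < 7 -> c k = c 0.
Proof.
move=> mono_c; have c3 : c 3 = c 0 by exact: (mono_c 0).
case=> [|[|[|[|[|[|[|//]]]]]]] _ //; try exact: (mono_c 0); try exact: (mono_c 1).
  (* Points 1 and 2 share no remaining line with 0, so they are compared with 3. *)
  by rewrite -c3; exact: (mono_c 2).
by rewrite -c3; exact: (mono_c 4).
Qed.

(* The removed line is the only one that can be monochromatic, and it must be so
   because the Fano plane has no blocking set. *)
Lemma fano_minus_line_blocking (c : nat -> bool) :
  (forall j, j < 6 -> (exists2 k, fano_minus_line j k & c k) /\
                      (exists2 k, fano_minus_line j k & ~~ c k)) ->
  [/\ c 1 = c 0, c 2 = c 0 & 1 < \sum_(1 <= k < 7) c k].
Proof.
move=> bl_c; have {bl_c}lines j : j < 6 ->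
    let l := nth [::] fano_lines j in has c l && ~~ all c l.
  by move/bl_c=> [ex_in ex_out]; apply/andP; split; [apply/hasP | apply/allPn].
move: {lines}(lines 0 isT) (lines 1 isT) (lines 2 isT) (lines 3 isT)
  (lines 4 isT) (lines 5 isT) => /=.
(* All 128 colourings are tried. The sum starts at 1 because point 0 is later identified with [p]
   and counted among the old points. *)
by rewrite unlock /=; case: (c 0); case: (c 1); case: (c 2); case: (c 3);
  case: (c 4); case: (c 5); case: (c 6).
Qed.

(** * Replacing a point by the Fano plane minus a line *)

Section PointExpansion.
Variables (v : nat) (A : 'I_v -> 'I_v -> bool) (p i1 i2 : 'I_v).
Hypotheses (Ai1 : A i1 p) (Ai2 : A i2 p) (neq_i : i1 != i2).

(* [p] splits into the three points of the removed Fano line: [p] itself, which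
   keeps the remaining blocks through [p], and the new points 0 and 1, which
   replace [p] in the blocks [i1] and [i2]. *)
Definition expand (i x : 'I_(v + 6)) : bool :=
  match split i, split x with
  | inl i, inl x => A i x && ~~ ((x == p) && ((i == i1) || (i == i2)))
  | inl i, inr k => (i == i1) && (k == 0 :> nat) || (i == i2) && (k == 1 :> nat)
  | inr j, inl x => (x == p) && fano_minus_line j 0
  | inr j, inr k => fano_minus_line j k.+1
  end.

Lemma expand_ll i x : expand (lshift 6 i) (lshift 6 x) =
  A i x && ~~ ((x == p) && ((i == i1) || (i == i2))).
Proof. by rewrite /expand !(unsplitK (inl _)). Qed.

Lemma expand_lr i (k : 'I_6) : expand (lshift 6 i) (rshift v k) =
  (i == i1) && (k == 0 :> nat) || (i == i2) && (k == 1 :> nat).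
Proof. by rewrite /expand (unsplitK (inl _)) (unsplitK (inr _)). Qed.

Lemma expand_rl (j : 'I_6) x : expand (rshift v j) (lshift 6 x) =
  (x == p) && fano_minus_line j 0.
Proof. by rewrite /expand (unsplitK (inl _)) (unsplitK (inr _)). Qed.

Lemma expand_rr (j k : 'I_6) : expand (rshift v j) (rshift v k) =
  fano_minus_line j k.+1.
Proof. by rewrite /expand !(unsplitK (inr _)). Qed.

Lemma sum_eq1 (a : 'I_v) : \sum_i (i == a) = 1.
Proof. by rewrite (bigD1 a) //= eqxx big1 // => i /negPf->. Qed.

Lemma expand_row : (forall i, \sum_x A i x = 3) ->
  forall i, \sum_x expand i x = 3.
Proof.
move=> rowA i; rewrite big_split_ord /=; case: (split_ordP i) => {}i ->.
  under eq_bigr do rewrite expand_ll.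
  under [X in _ + X]eq_bigr do rewrite expand_lr.
  (* Among the old points only the entry at [p] can change: where [i1] or [i2] drops [p], exactly
     one of the new points 0 and 1 makes up for it. *)
  rewrite -[RHS](rowA i) (bigD1 p) //= [RHS](bigD1 p) //= eqxx /=.
  rewrite (eq_bigr (fun x => A i x : nat)) => [|x /negPf-> /=]; last first.
    by rewrite andbT.
  rewrite !big_ord_recl big_ord0 /=.
  have [->|ni1] := eqVneq i i1; first by rewrite Ai1 (negPf neq_i) /= addnC.
  have [->|ni2] := eqVneq i i2; first by rewrite Ai2 /= addnC.
  by rewrite andbT ?addn0.
under eq_bigr do rewrite expand_rl -mulnb.
under [X in _ + X]eq_bigr do rewrite expand_rr.
rewrite -big_distrl /= sum_eq1 !big_ord_recl big_ord0.
by case: i => [[|[|[|[|[|[|//]]]]]] lt_i].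
Qed.

Lemma expand_col : (forall x, \sum_i A i x = 3) ->
  forall x, \sum_i expand i x = 3.
Proof.
move=> colA x; rewrite big_split_ord /=; case: (split_ordP x) => {}x ->.
  under eq_bigr do rewrite expand_ll.
  under [X in _ + X]eq_bigr do rewrite expand_rl.
  have := colA x; have [->|_] := eqVneq x p; last first.
    move=> sumA; rewrite -[RHS]sumA [X in _ + X]big1 // addn0.
    by apply: eq_bigr => i _; rewrite andbT.
  (* [p] loses [i1] and [i2], keeps one old block and gains the two Fano lines through 0, hence the
     [1 + 2] below. *)
  rewrite (bigD1 i1) //= (bigD1 i2) 1?eq_sym //= Ai1 Ai2 => -[sumA].
  rewrite (bigD1 i1) //= (bigD1 i2) 1?eq_sym //= !eqxx orbT !andbF !add0n.
  rewrite !big_ord_recl big_ord0 -[RHS]/(1 + 2); congr (_ + 2).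
  rewrite -[RHS]sumA; apply: eq_bigr => i /andP[/negPf-> /negPf->].
  by rewrite andbT.
under eq_bigr do rewrite expand_lr.
under [X in _ + X]eq_bigr do rewrite expand_rr.
rewrite !big_ord_recl big_ord0.
case: x => [[|[|[|[|[|[|//]]]]]] lt_x] /=;
  under eq_bigr do rewrite ?andbT ?andbF ?orbF ?orFb.
all: by rewrite ?sum_eq1 ?big1.
Qed.

Lemma expand_pair :
  (forall x y, x != y -> \sum_i (A i x && A i y) <= 1) ->
  forall x y, x != y -> \sum_i (expand i x && expand i y) <= 1.
Proof.
move=> pairA; have mixed x (k : 'I_6) :
    \sum_i (expand i (lshift 6 x) && expand i (rshift v k)) <= 1.
  rewrite big_split_ord /=.
  under eq_bigr do rewrite expand_ll expand_lr.
  under [X in _ + X]eq_bigr do rewrite expand_rl expand_rr.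
  rewrite !big_ord_recl big_ord0.
  (* New point [k] is Fano point [k + 1]. For [k > 1] it lies only on Fano lines; for [k <= 1] no
     remaining line joins it to Fano point 0, so only [i1], respectively [i2], can count. *)
  have [lt1k|] := ltnP 1 k.
    rewrite big1 => [|i _].
      by case: (x == p); case: k lt1k => [[|[|[|[|[|[|//]]]]]] lt_k].
    by rewrite !gtn_eqF ?(ltnW lt1k) // !andbF.
  move=> le_k1; rewrite [X in _ + X](_ : _ = 0); last first.
    by case: (x == p); case: k le_k1 => [[|[|//]] lt_k].
  rewrite addn0; case: k le_k1 => [[|[|//]] lt_k] _.
    rewrite -[X in _ <= X](sum_eq1 i1); apply: leq_sum => i _.
    by case: (i == i1); rewrite /= ?andbF ?leq_b1.
  rewrite -[X in _ <= X](sum_eq1 i2); apply: leq_sum => i _.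
  by case: (i == i2); rewrite /= ?andbF ?leq_b1.
move=> x y; case: (split_ordP x) => {}x ->; case: (split_ordP y) => {}y -> neq_xy.
- rewrite big_split_ord /= [X in _ + X]big1 ?addn0 => [|j _]; last first.
    rewrite !expand_rl; have [eqx|//] := eqVneq x p; have [eqy|] := eqVneq y p.
      by rewrite eqx eqy eqxx in neq_xy.
    by rewrite andbF.
  apply: leq_trans (pairA x y _); last by apply: contraNneq neq_xy => ->.
  apply: leq_sum => i _; rewrite !expand_ll.
  by case: (A i x) (A i y) => [] [] //=; rewrite ?andbF ?leq_b1.
- exact: mixed.
- by under eq_bigr do rewrite andbC; exact: mixed.
- rewrite big_split_ord /= big1 => [|i _]; last first.
    (* An old block through two distinct new points would receive both 0 and 1, forcing
       [i1 = i2]. *)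
    rewrite !expand_lr; apply/eqP; rewrite eqb0; apply: contraNN neq_xy.
    case/andP=> /orP[] /andP[/eqP-> /eqP x_k] /orP[] /andP[/eqP eq_i /eqP y_k].
    - by apply/eqP; congr rshift; apply: val_inj; rewrite /= x_k y_k.
    - by move: neq_i; rewrite eq_i eqxx.
    - by move: neq_i; rewrite eq_i eqxx.
    - by apply/eqP; congr rshift; apply: val_inj; rewrite /= x_k y_k.
  under eq_bigr do rewrite !expand_rr.
  rewrite !big_ord_recl big_ord0.
  have {neq_xy}: x != y :> nat by apply: contraNneq neq_xy => /val_inj->.
  by case: x => [[|[|[|[|[|[|//]]]]]] lt_x];
    case: y => [[|[|[|[|[|[|//]]]]]] lt_y].
Qed.

(** Position of Fano point [k] in the expansion. The index is a [nat] to match the colourings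
    [nat -> bool] of the Fano points; only [k < 7] is meaningful. *)
Definition gadget (k : nat) : 'I_(v + 6) :=
  if k is k'.+1 then rshift v (inord k' : 'I_6) else lshift 6 p.

Lemma gadgetS (k : 'I_6) : gadget k.+1 = rshift v k.
Proof. by rewrite /gadget inord_val. Qed.

Lemma expand_gadget (j : 'I_6) k :
  fano_minus_line j k -> expand (rshift v j) (gadget k).
Proof.
case: k => [|k] Fjk; first by rewrite expand_rl eqxx.
rewrite expand_rr inordK //.
by case: j Fjk => [[|[|[|[|[|[|//]]]]]] lt_j];
  rewrite /fano_minus_line !inE => /or3P[] /eqP // [->].
Qed.

Lemma expand_gadgetP (j : 'I_6) y :
  expand (rshift v j) y -> exists2 k, fano_minus_line j k & y = gadget k.
Proof.
case: (split_ordP y) => {}y ->.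
  by rewrite expand_rl => /andP[/eqP-> Fj0]; exists 0.
by rewrite expand_rr -gadgetS => Fjy; exists y.+1.
Qed.

(** Old blocks change only by having [gadget 1] or [gadget 2] in place of [p], which a predicate
    agreeing on the three split points cannot notice. It serves for a colouring, its complement, and
    equality with a given colour. *)
Lemma expand_oldP (P : 'I_(v + 6) -> bool) i :
    P (gadget 1) = P (gadget 0) -> P (gadget 2) = P (gadget 0) ->
  (exists2 y, expand (lshift 6 i) y & P y) <->
  (exists2 x, A i x & P (lshift 6 x)).
Proof.
move=> P1 P2; split=> [[y]|[x Aix Px]].
  case: (split_ordP y) => {}y ->.
    by rewrite expand_ll => /andP[Aiy _] Py; exists y.
  rewrite expand_lr -gadgetS.
  by case/orP=> /andP[/eqP-> /eqP->]; rewrite ?P1 ?P2; exists p.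
have [eq_xp|neq_xp] := eqVneq x p; last first.
  by exists (lshift 6 x); rewrite // expand_ll Aix (negPf neq_xp).
rewrite {x}eq_xp in Aix Px.
have [->|neq_i1] := eqVneq i i1.
  by exists (gadget 1); rewrite ?P1 // expand_lr eqxx inordK.
have [->|neq_i2] := eqVneq i i2.
  by exists (gadget 2); rewrite ?P2 // expand_lr eqxx inordK // orbT.
by exists (gadget 0); rewrite // expand_ll Aix (negPf neq_i1) (negPf neq_i2) andbF.
Qed.

Lemma expand_connected : connected_inc A -> connected_inc expand.
Proof.
move=> conA S monoS.
have S_gadget k : k < 7 -> S (gadget k) = S (gadget 0).
  move: k; apply: fano_minus_line_connected => j k l Fjk Fjl.
  (* An index past the six lines gives the default empty line, which has no point. *)
  have lt_j : j < 6.
    by rewrite ltnNge; apply/negP=> le6j; rewrite /fano_minus_line nth_default in Fjk.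
  by apply: (monoS (rshift v (Ordinal lt_j))); apply: expand_gadget.
suff S_p y : S y = S (gadget 0) by move=> x y; rewrite !S_p.
case: (split_ordP y) => {}y ->; last first.
  by rewrite -gadgetS; apply: S_gadget; exact: (ltn_ord y).
apply: (conA (fun x => S (lshift 6 x)) _ y p) => i {}y z Aiy Aiz.
(* The point [x] may have left block [i], but some point of the expanded block has its colour. *)
have lift x : A i x -> exists2 w, expand (lshift 6 i) w & S w == S (lshift 6 x).
  move=> Aix; pose P w := S w == S (lshift 6 x).
  by apply: (proj2 (@expand_oldP P i _ _)); rewrite /P ?S_gadget //; exists x.
have [[w1 ew1 /eqP<-] [w2 ew2 /eqP<-]] := (lift y Aiy, lift z Aiz).
exact: monoS ew1 ew2.
Qed.

Lemma expand_sum (Q : 'I_(v + 6) -> bool) :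
  \sum_y Q y = \sum_x Q (lshift 6 x) + \sum_(1 <= k < 7) Q (gadget k).
Proof.
rewrite big_split_ord /= big_add1 big_mkord; congr (_ + _).
by apply: eq_bigr => k _; rewrite -gadgetS.
Qed.

(** Adding to [Q] the two twins of [p] costs two points; conversely, a blocking set of the expansion
    restricts to one of [A] and has at least two further elements. *)
Lemma expand_blocking_number k Q :
    blocks A Q -> \sum_x Q x = k -> Q p ->
    (forall Q, blocks A Q -> k <= \sum_x Q x) ->
  blocking_number expand (k + 2).
Proof.
move=> blQ sumQ Qp minA; split=> [|{blQ sumQ Qp}Q blQ].
  pose Q' (y : 'I_(v + 6)) := match split y with inl x => Q x | inr k => k < 2 end.
  have Q'l x : Q' (lshift 6 x) = Q x by rewrite /Q' (unsplitK (inl _)).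
  have Q'g k' : k' < 7 -> Q' (gadget k') = (k' < 3).
    case: k' => [|k'] lt_k'; first by rewrite /= Q'l Qp.
    by rewrite /= /Q' (unsplitK (inr _)) inordK.
  exists Q'; last first.
    rewrite expand_sum; congr (_ + _).
      by rewrite -sumQ; apply: eq_bigr => x _; rewrite Q'l.
    by rewrite big_nat (eq_bigr (fun k' => k' < 3 : nat)) => [|k' /andP[_ /Q'g->//]];
      rewrite -big_nat unlock.
  move=> i; case: (split_ordP i) => {}i ->.
    have [[x Ax Qx] [y Ay Qy]] := blQ i; split.
      by apply: (proj2 (@expand_oldP Q' i _ _)); rewrite ?Q'g //;
        exists x; rewrite ?Q'l.
    by apply: (proj2 (@expand_oldP (fun y => ~~ Q' y) i _ _)); rewrite ?Q'g //;
      exists y; rewrite ?Q'l.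
  (* Lines [2m] and [2m + 1] of [fano_lines] meet the removed line in point [m], hence [i./2]. *)
  have [k1 [F1 lt1]] : exists k1, fano_minus_line i k1 /\ k1 < 3.
    by exists i./2; case: i => [[|[|[|[|[|[|//]]]]]] lt_i].
  (* The list gives, line by line, a point off the removed line. *)
  have [k2 [F2 gt2]] : exists k2, fano_minus_line i k2 /\ 2 < k2 < 7.
    by exists (nth 0 [:: 3; 5; 3; 4; 3; 4] i);
      case: i {F1} => [[|[|[|[|[|[|//]]]]]] lt_i].
  have [gt2' lt7] := andP gt2.
  split; [exists (gadget k1) | exists (gadget k2)]; rewrite ?expand_gadget ?Q'g //.
  - by apply: ltn_trans lt1 _.
  - by rewrite -leqNgt.
(* Lower bound: blocking the Fano lines yields the two extra elements and the agreement on split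
   points that [expand_oldP] requires. *)
have [|c1 c2 sum_c] := @fano_minus_line_blocking (fun k => Q (gadget k)).
  move=> j lt_j; have [[x Ex Qx] [y Ey Qy]] := blQ (rshift v (Ordinal lt_j)).
  have [k1 F1 eqx] := expand_gadgetP Ex; have [k2 F2 eqy] := expand_gadgetP Ey.
  by split; [exists k1 | exists k2]; rewrite // -?eqx -?eqy.
rewrite expand_sum leq_add //.
apply: minA => i; have [in_i out_i] := blQ (lshift 6 i).
split; first exact: (proj1 (@expand_oldP Q i c1 c2)).
by apply: (proj1 (@expand_oldP (fun y => ~~ Q y) i _ _)); rewrite ?c1 ?c2.
Qed.

Lemma expand_realizes k Q : realizes A k ->
  blocks A Q -> \sum_x Q x = k -> Q p -> realizes expand (k + 2).
Proof.
case=> -[rowA colA pairA] conA [_ minA] blQ sumQ Qp; split.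
- by split; [exact: expand_row | exact: expand_col | exact: expand_pair].
- exact: expand_connected.
- exact: (expand_blocking_number blQ).
Qed.

End PointExpansion.

(** A positive blocking number provides a point of a minimum blocking set, and degree 3 provides two
    distinct blocks through it to detach. *)
Lemma realizable_step v k : 0 < k -> realizable v k -> realizable (v + 6) (k + 2).
Proof.
move=> k_gt0 [A rA]; have [[_ colA _] _ [[Q blQ sumQ] _]] := rA.
have [p Qp] : exists p, Q p.
  apply/existsP; apply: contraTT k_gt0 => /existsPn noQ.
  by rewrite -sumQ big1 // => x _; rewrite (negPf (noQ x)).
have: 1 < \sum_i A i p by rewrite colA.
have [i1 A1 | noA] := pickP (fun i => A i p); last by rewrite big1 // => i; rewrite noA.
rewrite (bigD1 i1) //= A1 ltnS.
have [i2 /andP[neq_i A2] _ | noA] := pickP (fun i => (i != i1) && A i p).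
  exists (expand A p i1 i2).
  by apply: (expand_realizes _ _ _ _ blQ sumQ Qp) => //; rewrite eq_sym.
by rewrite big1 // => i neq_i; move: (noA i); rewrite neq_i => /= ->.
Qed.

(** * Certifying a small configuration by pruned search *)

Section Tables.
Variable t : seq (seq nat).

(* Conditionals rather than boolean connectives keep the pruning effective under
   call-by-value evaluation. *)
Fixpoint search (D leaf : pred bitseq) (n : nat) (s : bitseq) : bool :=
  if n is n'.+1 then
    let extend b := let s' := rcons s b in
      if all (fun l => all (gtn (size s')) l ==> D [seq nth false s' x | x <- l]) t
      then search D leaf n' s' else true in
    if extend true then extend false else false
  else leaf s.

(** Pruning is sound: once a line lies within the prefix, its letters are the same in every
    completion, so a failing line excludes them all. *)
Lemma searchP (D leaf : pred bitseq) n s : search D leaf n s ->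
  forall s2, size s2 = n ->
    all (fun l => D [seq nth false (s ++ s2) x | x <- l]) t -> leaf (s ++ s2).
Proof.
elim: n s => [|n IHn] s /= found [|b s2] //; first by rewrite cats0.
case=> size_s2; rewrite -cat_rcons => okD; apply: IHn => //.
have {found}: if all (fun l => all (gtn (size (rcons s b))) l ==>
    D [seq nth false (rcons s b) x | x <- l]) t
  then search D leaf n (rcons s b) else true.
  by case: b {okD}; move: found; case: ifP => // _; case: ifP.
rewrite ifT //; apply/allP=> l lt_l; apply/implyP=> /allP ready.
move/allP: okD => /(_ l lt_l); congr (is_true (D _)).
by apply/eq_in_map=> x /ready /= lt_x; rewrite nth_cat lt_x.
Qed.

Definition bichromatic (s : bitseq) := has id s && ~~ all id s.
Definition monochromatic (s : bitseq) := ~~ bichromatic s.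

Definition table_inc (i x : nat) : bool := x \in nth [::] t i.

(** The first search runs over colourings constant on lines and certifies connectivity; the second
    runs over blocking colourings and certifies the lower bound. The word [w] lists a blocking set
    for the upper bound. *)
Definition table_check (v k : nat) (w : seq nat) : bool :=
  let pts := iota 0 v in
  [&& size t == v, all (all (gtn v)) t,
      all (fun i => count (table_inc i) pts == 3) pts,
      all (fun x => count (table_inc^~ x) pts == 3) pts,
      all (fun x => all (fun y => (x != y) ==>
        (count (fun i => table_inc i x && table_inc i y) pts <= 1)) pts) pts,
      search monochromatic monochromatic v [::],
      search bichromatic (fun s => k <= count id s) v [::],
      all (fun l => bichromatic [seq x \in w | x <- l]) t
    & count [in w] pts == k].

Lemma sum_ord_count v (P : pred nat) : \sum_(i < v) P i = count P (iota 0 v).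
Proof.
rewrite -sum1_count -(big_mkord xpredT (fun i => P i : nat)) /index_iota subn0.
by rewrite [RHS]big_mkcond; apply: eq_bigr => i _; case: (P i).
Qed.

Lemma table_checkP v k w : table_check v k w ->
  realizes (fun i x : 'I_v => table_inc i x) k.
Proof.
case/and5P=> /eqP size_t /allP bound rows cols.
case/and5P=> pairs connect lower wit /eqP size_w.
(* Extends a colouring to [nat], false outside, so that it can be mapped over the lines of the
   table. *)
pose q (Q : 'I_v -> bool) n := oapp Q false (insub n).
have qE Q (x : 'I_v) : q Q x = Q x by rewrite /q valK.
pose word Q := [seq q Q x | x <- iota 0 v].
have size_word Q : size (word Q) = v by rewrite size_map size_iota.
have nth_word Q l : l \in t -> [seq nth false (word Q) x | x <- l] = map (q Q) l.
  move=> /bound/allP lt_l; apply/eq_in_map=> x /lt_l /= lt_x.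
  by rewrite (nth_map 0) ?size_iota // nth_iota.
have line_in (i : 'I_v) : nth [::] t i \in t by rewrite mem_nth ?size_t.
have all_lines (P : pred (seq nat)) : (forall i : 'I_v, P (nth [::] t i)) -> all P t.
  move=> P_line; apply/(all_nthP [::]) => i; rewrite size_t => lt_i.
  exact: (P_line (Ordinal lt_i)).
have bichromaticP (Q : 'I_v -> bool) (i : 'I_v) :
    reflect ((exists2 x : 'I_v, table_inc i x & Q x) /\
             (exists2 x : 'I_v, table_inc i x & ~~ Q x))
      (bichromatic (map (q Q) (nth [::] t i))).
  have lift (P : pred bool) :
      (exists2 x, x \in nth [::] t i & P (q Q x)) <->
      (exists2 x : 'I_v, table_inc i x & P (Q x)).
    split=> [[x lx Px]|[x lx Px]]; last by exists (val x); rewrite ?qE.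
    have lt_x : x < v by apply: (allP (bound _ (line_in i))).
    by exists (Ordinal lt_x); rewrite // -qE.
  rewrite /bichromatic has_map all_map; apply: (iffP andP).
    by case=> /hasP ex_in /allPn ex_out; split; [apply/(lift id)|apply/(lift negb)].
  by case=> /(lift id)/hasP ex_in /(lift negb)/allPn ex_out.
split.
- split=> [i|x|x y neq_xy].
  + rewrite (sum_ord_count v (table_inc i)).
    by apply/eqP/(allP rows); rewrite mem_iota /= ltn_ord.
  + rewrite (sum_ord_count v (table_inc^~ x)).
    by apply/eqP/(allP cols); rewrite mem_iota /= ltn_ord.
  + have mem_pts (z : 'I_v) : val z \in iota 0 v by rewrite mem_iota /= ltn_ord.
    rewrite (sum_ord_count v (fun i => table_inc i x && table_inc i y)).
    by have /implyP := allP (allP pairs _ (mem_pts x)) _ (mem_pts y); apply.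
- move=> S monoS; have: monochromatic (word S).
    apply: (searchP connect (size_word S)); apply: all_lines => i.
    rewrite nth_word //; apply/bichromaticP=> -[[x Ax Sx] [y Ay]].
    by rewrite -(monoS i x y Ax Ay) Sx.
  have in_word x : S x \in word S.
    by rewrite -qE map_f // mem_iota /= ltn_ord.
  rewrite /monochromatic negb_and negbK => /orP[/hasPn no_S|/allP all_S] x y.
    by rewrite (negPf (no_S _ (in_word x))) (negPf (no_S _ (in_word y))).
  by rewrite (all_S _ (in_word x)) (all_S _ (in_word y)).
- split.
    exists (fun x => val x \in w); last by rewrite (sum_ord_count _ [in w]).
    move=> i; apply/bichromaticP; have := allP wit _ (line_in i).
    congr (is_true (bichromatic _)); apply/eq_in_map => x.
    by move/(allP (bound _ (line_in i)))=> lt_x; rewrite (qE _ (Ordinal lt_x)).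
  move=> Q blQ; have := searchP lower (size_word Q).
  rewrite cat0s count_map -(sum_ord_count v (preim _ _)).
  rewrite (eq_bigr (fun x => Q x : nat)) => [|x _]; last by rewrite /= qE.
  by apply; apply: all_lines => i; rewrite nth_word //; apply/bichromaticP.
Qed.

End Tables.

(** * Explicit small configurations *)

Lemma realizable_8_4 : realizable 8 4.
Proof.
exists (fun i x => table_inc
  [:: [:: 0; 1; 2]; [:: 0; 3; 7]; [:: 0; 5; 6]; [:: 1; 3; 4]; [:: 1; 6; 7];
      [:: 2; 3; 5]; [:: 2; 4; 6]; [:: 4; 5; 7]] i x).
by apply: (@table_checkP _ 8 4 [:: 0; 1; 4; 5]); vm_compute.
Qed.

Lemma realizable_9_4 : realizable 9 4.
Proof.
exists (fun i x => table_inc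
  [:: [:: 0; 1; 2]; [:: 0; 3; 4]; [:: 0; 6; 8]; [:: 1; 3; 7]; [:: 1; 4; 8];
      [:: 2; 3; 5]; [:: 2; 6; 7]; [:: 4; 5; 6]; [:: 5; 7; 8]] i x).
by apply: (@table_checkP _ 9 4 [:: 0; 1; 5; 6]); vm_compute.
Qed.

Lemma realizable_10_5 : realizable 10 5.
Proof.
exists (fun i x => table_inc
  [:: [:: 0; 1; 2]; [:: 0; 4; 5]; [:: 0; 7; 8]; [:: 1; 3; 9]; [:: 1; 5; 8];
      [:: 2; 3; 4]; [:: 2; 7; 9]; [:: 3; 5; 6]; [:: 4; 6; 7]; [:: 6; 8; 9]] i x).
by apply: (@table_checkP _ 10 5 [:: 0; 1; 3; 6; 7]); vm_compute.
Qed.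

Lemma realizable_11_5 : realizable 11 5.
Proof.
exists (fun i x => table_inc
  [:: [:: 0; 1; 2]; [:: 0; 4; 5]; [:: 0; 8; 9]; [:: 1; 3; 10]; [:: 1; 5; 7];
      [:: 2; 3; 4]; [:: 2; 8; 10]; [:: 3; 5; 6]; [:: 4; 6; 9]; [:: 6; 7; 8];
      [:: 7; 9; 10]] i x).
by apply: (@table_checkP _ 11 5 [:: 0; 1; 4; 6; 10]); vm_compute.
Qed.

Lemma realizable_12_5 : realizable 12 5.
Proof.
exists (fun i x => table_inc
  [:: [:: 0; 1; 2]; [:: 0; 3; 5]; [:: 0; 9; 10]; [:: 1; 3; 4];
      [:: 1; 9; 11]; [:: 2; 6; 7]; [:: 2; 8; 10]; [:: 3; 7; 8]; [:: 4; 5; 6];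
      [:: 4; 10; 11]; [:: 5; 7; 11]; [:: 6; 8; 9]] i x).
by apply: (@table_checkP _ 12 5 [:: 0; 1; 4; 7; 8]); vm_compute.
Qed.

Lemma realizable_13_6 : realizable 13 6.
Proof.
exists (fun i x => table_inc
  [:: [:: 0; 1; 2]; [:: 0; 4; 5]; [:: 0; 8; 11]; [:: 1; 3; 4]; [:: 1; 5; 6];
      [:: 2; 3; 9]; [:: 2; 7; 8]; [:: 3; 6; 7]; [:: 4; 11; 12]; [:: 5; 10; 12];
      [:: 6; 8; 10]; [:: 7; 9; 12]; [:: 9; 10; 11]] i x).
by apply: (@table_checkP _ 13 6 [:: 0; 1; 3; 7; 10; 11]); vm_compute.
Qed.

(** The isolated value 12 of the second claim; its expansion also settles 18. *)
Lemma realizable_12_6 : realizable 12 6.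
Proof.
exists (fun i x => table_inc
  [:: [:: 0; 1; 2]; [:: 0; 3; 5]; [:: 0; 6; 7]; [:: 1; 3; 11];
      [:: 1; 4; 10]; [:: 2; 3; 4]; [:: 2; 5; 6]; [:: 4; 9; 11]; [:: 5; 7; 8];
      [:: 6; 8; 9]; [:: 7; 9; 10]; [:: 8; 10; 11]] i x).
by apply: (@table_checkP _ 12 6 [:: 0; 1; 4; 5; 8; 9]); vm_compute.
Qed.

Lemma realizable_15_7 : realizable 15 7.
Proof.
exists (fun i x => table_inc
  [:: [:: 0; 1; 2]; [:: 0; 4; 6]; [:: 0; 7; 9]; [:: 1; 3; 5];
      [:: 1; 11; 14]; [:: 2; 3; 4]; [:: 2; 5; 6]; [:: 3; 13; 14]; [:: 4; 7; 8];
      [:: 5; 12; 14]; [:: 6; 7; 10]; [:: 8; 9; 10]; [:: 8; 11; 12];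
      [:: 9; 12; 13]; [:: 10; 11; 13]] i x).
by apply: (@table_checkP _ 15 7 [:: 0; 1; 3; 6; 8; 10; 12]); vm_compute.
Qed.

Lemma realizable_16_8 : realizable 16 8.
Proof.
exists (fun i x => table_inc
  [:: [:: 0; 1; 2]; [:: 0; 9; 11]; [:: 0; 10; 13]; [:: 1; 3; 6];
      [:: 1; 4; 5]; [:: 2; 3; 4]; [:: 2; 9; 10]; [:: 3; 12; 15]; [:: 4; 14; 15];
      [:: 5; 6; 7]; [:: 5; 8; 14]; [:: 6; 8; 12]; [:: 7; 8; 9]; [:: 7; 10; 11];
      [:: 11; 13; 15]; [:: 12; 13; 14]] i x).
by apply: (@table_checkP _ 16 8 [:: 0; 1; 3; 7; 8; 10; 14; 15]); vm_compute.
Qed.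

Lemma realizable_17_8 : realizable 17 8.
Proof.
exists (fun i x => table_inc
  [:: [:: 0; 1; 2]; [:: 0; 3; 12]; [:: 0; 4; 5]; [:: 1; 3; 8];
      [:: 1; 9; 10]; [:: 2; 3; 4]; [:: 2; 5; 6]; [:: 4; 6; 7]; [:: 5; 7; 11];
      [:: 6; 11; 13]; [:: 7; 8; 9]; [:: 8; 10; 16]; [:: 9; 14; 16];
      [:: 10; 14; 15]; [:: 11; 12; 15]; [:: 12; 13; 14]; [:: 13; 15; 16]] i x).
by apply: (@table_checkP _ 17 8 [:: 0; 1; 3; 6; 7; 11; 14; 16]); vm_compute.
Qed.

Lemma realizable_19_9 : realizable 19 9.
Proof.
exists (fun i x => table_inc
  [:: [:: 0; 1; 2]; [:: 0; 6; 9]; [:: 0; 8; 10]; [:: 1; 3; 8]; [:: 1; 4; 5];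
      [:: 2; 3; 4]; [:: 2; 5; 6]; [:: 3; 5; 7]; [:: 4; 17; 18]; [:: 6; 7; 10];
      [:: 7; 8; 9]; [:: 9; 10; 11]; [:: 11; 12; 13]; [:: 11; 14; 16];
      [:: 12; 14; 17]; [:: 12; 15; 18]; [:: 13; 14; 15]; [:: 13; 16; 18];
      [:: 15; 16; 17]] i x).
by apply: (@table_checkP _ 19 9 [:: 0; 1; 3; 6; 7; 11; 13; 15; 17]); vm_compute.
Qed.

Lemma realizable_20_9 : realizable 20 9.
Proof.
exists (fun i x => table_inc
  [:: [:: 0; 1; 2]; [:: 0; 6; 8]; [:: 0; 9; 10]; [:: 1; 3; 5];
      [:: 1; 10; 13]; [:: 2; 3; 4]; [:: 2; 6; 7]; [:: 3; 16; 18]; [:: 4; 6; 12];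
      [:: 4; 7; 11]; [:: 5; 8; 9]; [:: 5; 18; 19]; [:: 7; 8; 14];
      [:: 9; 11; 19]; [:: 10; 11; 12]; [:: 12; 13; 15]; [:: 13; 14; 17];
      [:: 14; 15; 16]; [:: 15; 17; 18]; [:: 16; 17; 19]] i x).
by apply: (@table_checkP _ 20 9 [:: 0; 1; 3; 7; 8; 12; 15; 17; 19]); vm_compute.
Qed.

(** * Induction in steps of six points *)

(** The ceiling grows exactly as fast as the blocking number under expansion, so the excess over
    [ceil3] is preserved. *)
Lemma ceil3D v m : ceil3 (v + m * 6) = ceil3 v + m * 2.
Proof. by rewrite /ceil3 addnAC -[m * 6]/(m * (2 * 3)) mulnA divnDMl. Qed.

Lemma realizable_iter v k m : 0 < k -> realizable v k ->
  realizable (v + m * 6) (k + m * 2).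
Proof.
move=> k_gt0 rv; elim: m => [|m IHm]; first by rewrite !addn0.
rewrite !mulSn [6 + _]addnC [2 + _]addnC !addnA.
by apply: realizable_step; rewrite // addn_gt0 k_gt0.
Qed.

(** Six consecutive base values represent every residue modulo 6; repeated expansion reaches all
    larger [v] with the same excess [d]. *)
Lemma realizable_from n d : 0 < d ->
  (forall r, r < 6 -> realizable (n + r) (ceil3 (n + r) + d)) ->
  forall v, n <= v -> realizable v (ceil3 v + d).
Proof.
move=> d_gt0 base v le_nv; rewrite -(subnKC le_nv) (divn_eq (v - n) 6).
rewrite [_ * 6 + _]addnC addnA ceil3D [ceil3 _ + _ + d]addnAC.
by apply: realizable_iter; [rewrite addn_gt0 d_gt0 orbT | apply/base/ltn_mod].
Qed.

Theorem mainTheorem3 :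
  (forall v : nat, 8 <= v ->
     exists B : 'I_v -> {set 'I_v},
       [/\ is_config3 B, config_connected B & min_blocking_card B (ceil3 v + 1)]) /\
  (forall v : nat, (v = 12 \/ 15 <= v) ->
     exists B : 'I_v -> {set 'I_v},
       [/\ is_config3 B, config_connected B & min_blocking_card B (ceil3 v + 2)]).
Proof.
split=> [v v_ge8|v v_in]; apply: realizable_blocks.
  apply: (realizable_from (n := 8)) => // -[|[|[|[|[|[|//]]]]]] _.
  - exact: realizable_8_4.
  - exact: realizable_9_4.
  - exact: realizable_10_5.
  - exact: realizable_11_5.
  - exact: realizable_12_5.
  - exact: realizable_13_6.
case: v_in => [->|v_ge15]; first exact: realizable_12_6.
apply: (realizable_from (n := 15)) => // -[|[|[|[|[|[|//]]]]]] _.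
- exact: realizable_15_7.
- exact: realizable_16_8.
- exact: realizable_17_8.
(* 18 points arise from 12 by one expansion, with blocking number 6 + 2. *)
- exact: (realizable_step (v := 12) _ realizable_12_6).
- exact: realizable_19_9.
- exact: realizable_20_9.
Qed.
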